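(* Let $\Omega\subset\mathbb H^2$ be a bounded smooth horoconvex domain and let $h\subset\mathbb H^2$ be a complete embedded curve of constant geodesic curvature $\kappa_0\in[0,1)$, that is, a geodesic or an equidistant curve. Then $\partial\Omega\cap h$ contains at most two points.
   Context: $\mathbb H^2$ is the hyperbolic plane with its metric of constant curvature $-1$. A horoball in $\mathbb H^2$ is a closed sublevel set $\{b\le c\}$ of a Busemann function $b$. A bounded smooth domain (bounded connected open set with smooth boundary) $\Omega\subset\mathbb H^2$ is horoconvex if its closure is an intersection of horoballs. An equidistant curve of a complete geodesic $\gamma$ is a level curve of the signed distance to $\gamma$. For a unit-speed parametrization $h:\mathbb R\to\mathbb H^2$, having constant geodesic curvature $\kappa_0$ means $|\nabla_{h'}h'|=\kappa_0$. *)

(* Defs.v *)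
From Stdlib Require Import Reals.
From Coquelicot Require Import Coquelicot.
Local Open Scope R_scope.

(** The hyperbolic plane is the upper half-plane [{(x, y) | y > 0}] with the
    metric [(dx^2 + dy^2) / y^2], of constant curvature -1. *)

Record H2 : Type := mkH2 { hx : R; hy : R; hy_pos : 0 < hy }.

Definition h2_set : Type := H2 -> Prop.

(** Riemannian length of the tangent vector [(a, b)] at [p]. *)
Definition hnorm (p : H2) (a b : R) : R := sqrt (a ^ 2 + b ^ 2) / hy p.

(** Riemannian distance, in the closed form
    [sinh (d / 2) = |p - q| / (2 sqrt (Im p * Im q))]. *)
Definition hdist (p q : H2) : R :=
  2 * arcsinh (sqrt ((hx p - hx q) ^ 2 + (hy p - hy q) ^ 2)
               / (2 * sqrt (hy p * hy q))).

Definition h2_open (U : h2_set) : Prop :=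
  forall p, U p -> exists eps, 0 < eps /\ forall q, hdist p q < eps -> U q.

Definition h2_closure (A : h2_set) : h2_set :=
  fun p => forall eps, 0 < eps -> exists q, A q /\ hdist p q < eps.

Definition h2_boundary (A : h2_set) : h2_set :=
  fun p => h2_closure A p /\ h2_closure (fun q => ~ A q) p.

Definition h2_bounded (A : h2_set) : Prop :=
  exists (p0 : H2) (r : R), forall q, A q -> hdist p0 q <= r.

Definition h2_open_connected (A : h2_set) : Prop :=
  forall U V : h2_set,
    h2_open U -> h2_open V ->
    (forall p, A p <-> U p \/ V p) ->
    (forall p, ~ (U p /\ V p)) ->
    (forall p, ~ U p) \/ (forall p, ~ V p).

(** [F] is a function of the coordinates; only its values on [U] matter, since
    [U] is open whenever this is used. *)
Definition smooth_on (U : h2_set) (F : R -> R -> R) : Prop :=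
  forall p, U p -> forall n : nat, ex_diff_n F n (hx p) (hy p).

Definition smooth_boundary (Om : h2_set) : Prop :=
  forall p, h2_boundary Om p ->
  exists (U : h2_set) (F : R -> R -> R),
    h2_open U /\ U p /\ smooth_on U F /\
    (forall q, U q -> Derive (fun x => F x (hy q)) (hx q) <> 0 \/
                      Derive (fun y => F (hx q) y) (hy q) <> 0) /\
    (forall q, U q -> (Om q <-> F (hx q) (hy q) < 0)) /\
    (forall q, U q -> (h2_boundary Om q <-> F (hx q) (hy q) = 0)).

Definition bounded_smooth_domain (Om : h2_set) : Prop :=
  h2_open Om /\ h2_open_connected Om /\ h2_bounded Om /\ smooth_boundary Om.

Definition cx (h : R -> H2) (t : R) : R := hx (h t).
Definition cy (h : R -> H2) (t : R) : R := hy (h t).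

Definition smooth_curve (h : R -> H2) : Prop :=
  forall (n : nat) (t : R), ex_derive_n (cx h) n t /\ ex_derive_n (cy h) n t.

Definition unit_speed (h : R -> H2) : Prop :=
  forall t, hnorm (h t) (Derive (cx h) t) (Derive (cy h) t) = 1.

(** The two components of the covariant acceleration. The nonzero Christoffel
    symbols of [(dx^2 + dy^2) / y^2] are [Gamma^x_xy = Gamma^x_yx = - 1 / y],
    [Gamma^y_xx = 1 / y] and [Gamma^y_yy = - 1 / y]. *)
Definition cov_acc_x (h : R -> H2) (t : R) : R :=
  Derive_n (cx h) 2 t - 2 * Derive (cx h) t * Derive (cy h) t / cy h t.

Definition cov_acc_y (h : R -> H2) (t : R) : R :=
  Derive_n (cy h) 2 t + (Derive (cx h) t ^ 2 - Derive (cy h) t ^ 2) / cy h t.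

Definition geodesic_curvature (h : R -> H2) (t : R) : R :=
  hnorm (h t) (cov_acc_x h t) (cov_acc_y h t).

(** Being defined on all of [R] with unit speed, such curves are complete. *)
Definition complete_curve_of_curvature (kappa0 : R) (h : R -> H2) : Prop :=
  smooth_curve h /\ unit_speed h /\ forall t, geodesic_curvature h t = kappa0.

Definition complete_geodesic (g : R -> H2) : Prop :=
  complete_curve_of_curvature 0 g.

(** Homeomorphism onto the image; immersivity comes from unit speed. *)
Definition embedded (h : R -> H2) : Prop :=
  (forall s t, h s = h t -> s = t) /\
  (forall t eps, 0 < eps -> exists delta, 0 < delta /\
     forall s, hdist (h t) (h s) < delta -> Rabs (s - t) < eps).

Definition image (h : R -> H2) : h2_set := fun p => exists t, h t = p.

(** Every geodesic ray of the hyperbolic plane extends to a complete geodesic,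
    so the rays are the restrictions of complete geodesics to [t >= 0]. *)
Definition busemann_of (g : R -> H2) (b : H2 -> R) : Prop :=
  forall p, is_lim (fun t => hdist p (g t) - t) p_infty (b p).

Definition busemann (b : H2 -> R) : Prop :=
  exists g, complete_geodesic g /\ busemann_of g b.

Definition horoball (B : h2_set) : Prop :=
  exists (b : H2 -> R) (c : R), busemann b /\ forall p, B p <-> b p <= c.

Definition horoconvex (Om : h2_set) : Prop :=
  exists F : h2_set -> Prop,
    (forall B, F B -> horoball B) /\
    (forall p, h2_closure Om p <-> forall B, F B -> B p).

(* Main.v *)
Require Import Defs.
From Stdlib Require Import Reals Lra.
From Coquelicot Require Import Coquelicot.
Local Open Scope R_scope.

(** Let [h] pass through [h a], [h b], [h c] with [a < b < c], all three in the
    boundary. The point is that a whole neighbourhood of the middle point [h b]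
    lies in every horoball containing the two outer points, hence in the closure
    of the horoconvex domain, whereas a smooth boundary has exterior points in
    every neighbourhood of [h b].

    A horoball is a limit of metric balls, because a Busemann function is the
    limit of [hdist p (g t) - t]. So it suffices to show that, for [q'] near
    [h b] and for every centre [P],
    [hdist q' P <= max (hdist (h a) P, hdist (h c) P)], with a neighbourhood
    independent of [P]: the inequality then survives the limit
    ([busemann_le_max]).

    For the uniform inequality, let [f t] be the hyperbolic cosine of the
    distance from [h t] to [P]. The Hessian of [cosh (dist P)] is
    [cosh (dist P)] times the metric and its gradient has norm
    [sinh (dist P)], so along a curve of curvature [kappa < 1]
    [f'' >= f - kappa sinh (dist P) >= (1 - kappa) f]. Sturm comparison with
    [cosh (k (t - b))], where [k ^ 2 = 1 - kappa], shows that [f b] is smaller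
    than the larger of [f a] and [f c] by a factor that depends on [a], [b], [c]
    and [kappa] only ([hcosh_strict_quasiconvex]). Moving [h b] slightly changes
    [f b] by a factor close to 1 uniformly in [P] ([hcosh_coord_near]), which the
    gap absorbs. *)

(** * The hyperbolic cosine of the distance *)

(** This is [cosh (hdist p q)]: unlike the distance itself, a rational function
    of the coordinates. *)
Definition hcosh (p q : H2) : R :=
  ((hx p - hx q) ^ 2 + hy p ^ 2 + hy q ^ 2) / (2 * hy p * hy q).

Lemma hcosh_pos (p q : H2) : 0 < hcosh p q.
Proof.
  unfold hcosh. pose proof (hy_pos p). pose proof (hy_pos q).
  apply Rdiv_lt_0_compat; [|nra].
  pose proof (pow2_ge_0 (hx p - hx q)). nra.
Qed.

(** The half-angle formula [cosh d - 1 = 2 sinh (d / 2) ^ 2]. *)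
Lemma hdist_hcosh (p q : H2) :
  hdist p q = 2 * arcsinh (sqrt ((hcosh p q - 1) / 2)).
Proof.
  pose proof (hy_pos p) as Hp. pose proof (hy_pos q) as Hq.
  assert (Hpq : 0 < hy p * hy q) by nra.
  unfold hdist. do 2 f_equal.
  replace (2 * sqrt (hy p * hy q)) with (sqrt (4 * (hy p * hy q))).
  - rewrite <- sqrt_div_alt by lra. f_equal. unfold hcosh. field. lra.
  - rewrite sqrt_mult by lra. f_equal.
    replace 4 with (2 * 2) by ring. apply sqrt_square. lra.
Qed.

Lemma hdist_le_of_hcosh_le (p q P : H2) :
  hcosh p P <= hcosh q P -> hdist p P <= hdist q P.
Proof.
  intros H. rewrite 2!hdist_hcosh.
  apply Rmult_le_compat_l; [lra|]. apply arcsinh_le, sqrt_le_1_alt. lra.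
Qed.

Lemma hdist_refl (p : H2) : hdist p p = 0.
Proof.
  pose proof (hy_pos p) as Hp.
  rewrite hdist_hcosh. unfold hcosh.
  replace ((((hx p - hx p) ^ 2 + hy p ^ 2 + hy p ^ 2) / (2 * hy p * hy p) - 1) / 2)
    with 0 by (field; lra).
  rewrite sqrt_0, arcsinh_0. ring.
Qed.

(** Coordinate boxes of side proportional to the height. The scaling makes the
    estimates below depend on [eta] alone, as dilations are isometries; boxes
    rather than balls because the exterior points are found by moving one
    coordinate. *)
Definition coord_near (eta : R) (p q : H2) : Prop :=
  Rabs (hx q - hx p) <= eta * hy p /\ Rabs (hy q - hy p) <= eta * hy p.

Lemma hdist_coord_near (eta : R) (p q : H2) :
  0 <= eta <= 1 / 2 -> coord_near eta p q -> hdist p q <= 2 * arcsinh eta.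
Proof.
  intros Heta [Hx Hy].
  pose proof (hy_pos p) as Hp. pose proof (hy_pos q) as Hq.
  apply Rabs_le_between in Hx. apply Rabs_le_between in Hy.
  rewrite hdist_hcosh. apply Rmult_le_compat_l; [lra|]. apply arcsinh_le.
  rewrite <- (sqrt_Rsqr eta) by lra. apply sqrt_le_1_alt.
  unfold Rsqr, hcosh.
  replace ((((hx p - hx q) ^ 2 + hy p ^ 2 + hy q ^ 2) / (2 * hy p * hy q) - 1) / 2)
    with (((hx q - hx p) ^ 2 + (hy q - hy p) ^ 2) / (4 * (hy p * hy q)))
    by (field; lra).
  assert (Hpq : 0 < hy p * hy q) by nra.
  apply Rle_div_l; [lra|].
  assert ((hx q - hx p) ^ 2 <= (eta * hy p) ^ 2) by (apply pow_maj_Rabs, Rabs_le; lra).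
  assert ((hy q - hy p) ^ 2 <= (eta * hy p) ^ 2) by (apply pow_maj_Rabs, Rabs_le; lra).
  assert (hy p * hy p <= 2 * (hy p * hy q)) by nra.
  assert (eta * eta * (hy p * hy p) <= eta * eta * (2 * (hy p * hy q)))
    by (apply Rmult_le_compat_l; nra).
  nra.
Qed.

(** The infinitesimal form of [cosh (d + e) <= exp e * cosh d]: the relative
    change of [hcosh _ P] is bounded uniformly in the centre [P]. The numerator
    of [hcosh] grows by at most the factor [1 + 5 eta], since it dominates
    [hy p ^ 2] and [2 |hx p - hx P| hy p]; the height in the denominator shrinks
    by at most [1 - eta]. *)
Lemma hcosh_coord_near (eta : R) (p q P : H2) :
  0 <= eta < 1 -> coord_near eta p q ->
  (1 - eta) * hcosh q P <= (1 + 5 * eta) * hcosh p P.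
Proof.
  intros Heta [Hx Hy].
  pose proof (hy_pos p) as Hp. pose proof (hy_pos q) as Hq.
  pose proof (hy_pos P) as HP.
  apply Rabs_le_between in Hx. apply Rabs_le_between in Hy.
  unfold hcosh.
  set (D := hx p - hx P). set (u := hx q - hx p) in *. set (v := hy q - hy p) in *.
  replace (hx q - hx P) with (D + u) by (unfold D, u; ring).
  set (N := D ^ 2 + hy p ^ 2 + hy P ^ 2).
  assert (HN : 0 < N) by (unfold N; nra).
  assert (HN' : (D + u) ^ 2 + hy q ^ 2 + hy P ^ 2 <= (1 + 5 * eta) * N).
  { replace (hy q) with (hy p + v) by (unfold v; ring).
    assert (Hu2 : u ^ 2 <= (eta * hy p) ^ 2) by (apply pow_maj_Rabs, Rabs_le; lra).
    assert (Hv2 : v ^ 2 <= (eta * hy p) ^ 2) by (apply pow_maj_Rabs, Rabs_le; lra).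
    assert (HyN : hy p ^ 2 <= N) by (unfold N; nra).
    assert (He2 : (eta * hy p) ^ 2 <= eta * N).
    { replace ((eta * hy p) ^ 2) with (eta * (eta * hy p ^ 2)) by ring.
      apply Rmult_le_compat_l; [lra|]. pose proof (pow2_ge_0 (hy p)). clearbody N. nra. }
    assert (HDu : 2 * (D * u) <= eta * N).
    { assert (D * u <= Rabs D * (eta * hy p)).
      { apply Rle_trans with (1 := Rle_abs _). rewrite Rabs_mult.
        apply Rmult_le_compat_l; [apply Rabs_pos|apply Rabs_le; lra]. }
      assert (2 * (Rabs D * hy p) <= N).
      { unfold N. rewrite <- (pow2_abs D).
        pose proof (pow2_ge_0 (Rabs D - hy p)). pose proof (pow2_ge_0 (hy P)). nra. }
      clearbody N. nra. }
    assert (Hyv : hy p * v <= eta * N).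
    { apply Rle_trans with (hy p * (eta * hy p)).
      - apply Rmult_le_compat_l; lra.
      - clearbody N. nra. }
    replace ((D + u) ^ 2 + (hy p + v) ^ 2 + hy P ^ 2)
      with (N + 2 * (D * u) + 2 * (hy p * v) + u ^ 2 + v ^ 2) by (unfold N; ring).
    lra. }
  assert (Hq' : (1 - eta) * hy p <= hy q) by (unfold v in Hy; lra).
  replace ((1 + 5 * eta) * (N / (2 * hy p * hy P)))
    with ((1 + 5 * eta) * N / (2 * hy p * hy P)) by (field; lra).
  apply -> Rle_div_r; [|apply Rmult_lt_0_compat; lra].
  apply Rle_trans with ((1 + 5 * eta) * N * ((1 - eta) * hy p / hy q)).
  - replace ((1 - eta) * (((D + u) ^ 2 + hy q ^ 2 + hy P ^ 2) / (2 * hy q * hy P))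
             * (2 * hy p * hy P))
      with (((D + u) ^ 2 + hy q ^ 2 + hy P ^ 2) * ((1 - eta) * hy p / hy q))
      by (field; lra).
    apply Rmult_le_compat_r; [|exact HN'].
    apply -> Rle_div_r; nra.
  - rewrite <- (Rmult_1_r ((1 + 5 * eta) * N)) at 2.
    apply Rmult_le_compat_l; [nra|]. apply Rle_div_l; lra.
Qed.

(** * Convexity along a curve of curvature less than 1 *)

(** The coordinate partial derivatives of [hcosh _ P]. *)
Definition grad_x (P p : H2) : R := (hx p - hx P) / (hy p * hy P).

Definition grad_y (P p : H2) : R :=
  (1 - ((hx p - hx P) ^ 2 + hy P ^ 2) / hy p ^ 2) / (2 * hy P).

(** The metric norm of the gradient of [cosh d] is [sinh d]. *)
Lemma hcosh_grad_norm (P p : H2) :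
  (hy p * grad_x P p) ^ 2 + (hy p * grad_y P p) ^ 2 = hcosh p P ^ 2 - 1.
Proof.
  pose proof (hy_pos p). pose proof (hy_pos P).
  unfold grad_x, grad_y, hcosh. field. lra.
Qed.

Lemma hcosh_derive_1 (h : R -> H2) (P : H2) (t : R) : smooth_curve h ->
  is_derive (fun s => hcosh (h s) P) t
    (grad_x P (h t) * Derive (cx h) t + grad_y P (h t) * Derive (cy h) t).
Proof.
  intros Hs.
  pose proof (hy_pos (h t)) as Hy. pose proof (hy_pos P) as HP.
  apply (is_derive_ext
    (fun s => ((cx h s - hx P) ^ 2 + cy h s ^ 2 + hy P ^ 2) / (2 * cy h s * hy P)));
    [reflexivity|].
  pose proof (proj1 (Hs 1%nat t)) as Ex. pose proof (proj2 (Hs 1%nat t)) as Ey.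
  simpl in Ex, Ey.
  assert (0 < cy h t) by exact Hy.
  auto_derive.
  - repeat split; try assumption. nra.
  - unfold grad_x, grad_y. fold (cx h t) (cy h t).
    change (Derive (fun x => cx h x) t) with (Derive (cx h) t).
    change (Derive (fun x => cy h x) t) with (Derive (cy h) t).
    field. lra.
Qed.

(** The Hessian of [hcosh _ P] is [hcosh _ P] times the metric, which on a
    unit-speed velocity gives the first term; the second is the differential
    applied to the covariant acceleration. *)
Lemma hcosh_derive_2 (h : R -> H2) (P : H2) (t : R) : smooth_curve h -> unit_speed h ->
  is_derive
    (fun s => grad_x P (h s) * Derive (cx h) s + grad_y P (h s) * Derive (cy h) s) t
    (hcosh (h t) P
     + (grad_x P (h t) * cov_acc_x h t + grad_y P (h t) * cov_acc_y h t)).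
Proof.
  intros Hs Hu.
  pose proof (hy_pos (h t)) as Hy. pose proof (hy_pos P) as HP.
  assert (Hspeed : Derive (cx h) t ^ 2 + Derive (cy h) t ^ 2 = cy h t ^ 2).
  { specialize (Hu t). unfold hnorm in Hu. fold (cy h t) in Hy, Hu.
    set (S := Derive (cx h) t ^ 2 + Derive (cy h) t ^ 2) in *.
    assert (HS : 0 <= S) by (unfold S; nra).
    rewrite <- (pow2_sqrt S HS). f_equal.
    replace (sqrt S) with (sqrt S / cy h t * cy h t) by (field; lra).
    rewrite Hu. ring. }
  pose proof (proj1 (Hs 1%nat t)) as Ex. pose proof (proj2 (Hs 1%nat t)) as Ey.
  pose proof (proj1 (Hs 2%nat t)) as Ex2. pose proof (proj2 (Hs 2%nat t)) as Ey2.
  simpl in Ex, Ey.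
  change (ex_derive (Derive (cx h)) t) in Ex2.
  change (ex_derive (Derive (cy h)) t) in Ey2.
  assert (0 < cy h t) by exact Hy.
  apply (is_derive_ext
    (fun s => (cx h s - hx P) / (cy h s * hy P) * Derive (cx h) s
       + (1 - ((cx h s - hx P) ^ 2 + hy P ^ 2) / cy h s ^ 2) / (2 * hy P)
         * Derive (cy h) s)); [reflexivity|].
  set (X' := Derive (cx h)) in *. set (Y' := Derive (cy h)) in *.
  auto_derive.
  - repeat split; try assumption; nra.
  - unfold cov_acc_x, cov_acc_y, grad_x, grad_y, hcosh. fold (cx h t) (cy h t).
    change (Derive_n (cx h) 2 t) with (Derive X' t).
    change (Derive_n (cy h) 2 t) with (Derive Y' t).
    fold X' Y'.
    change (Derive (fun x => cx h x) t) with (X' t).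
    change (Derive (fun x => cy h x) t) with (Y' t).
    change (Derive (fun x => X' x) t) with (Derive X' t).
    change (Derive (fun x => Y' x) t) with (Derive Y' t).
    set (D := cx h t - hx P). set (y := cy h t) in *. set (Y := hy P) in *.
    (* Homogenizing the Hessian term in the velocity makes the identity hold
       for every speed, so that field arithmetic alone proves it. *)
    replace ((D ^ 2 + y ^ 2 + Y ^ 2) / (2 * y * Y))
      with ((D ^ 2 + y ^ 2 + Y ^ 2) / (2 * y * Y) * ((X' t ^ 2 + Y' t ^ 2) / y ^ 2))
      by (rewrite Hspeed; field; lra).
    unfold D. field. lra.
Qed.

(** Cauchy-Schwarz: the gradient has norm [sinh d <= cosh d] and the acceleration
    has norm [kappa]. *)
Lemma hcosh_grad_acc_bound (h : R -> H2) (kappa : R) (P : H2) (t : R) :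
  0 <= kappa -> geodesic_curvature h t = kappa ->
  - kappa * hcosh (h t) P
    <= grad_x P (h t) * cov_acc_x h t + grad_y P (h t) * cov_acc_y h t.
Proof.
  intros Hk Hc. unfold geodesic_curvature, hnorm in Hc.
  pose proof (hy_pos (h t)) as Hy. pose proof (hcosh_pos (h t) P) as Hf.
  pose proof (hcosh_grad_norm P (h t)) as Hg.
  set (ax := cov_acc_x h t) in *. set (ay := cov_acc_y h t) in *.
  set (y := hy (h t)) in *. set (f := hcosh (h t) P) in *.
  set (gx := grad_x P (h t)) in *. set (gy := grad_y P (h t)) in *.
  assert (Hacc : ax ^ 2 + ay ^ 2 = (kappa * y) ^ 2).
  { assert (HS : 0 <= ax ^ 2 + ay ^ 2) by nra.
    rewrite <- (pow2_sqrt _ HS). f_equal. rewrite <- Hc. field. lra. }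
  apply Rnot_lt_le. intros Hlt.
  assert (Hsq : (kappa * f) ^ 2 < (gx * ax + gy * ay) ^ 2) by (assert (0 <= kappa * f); nra).
  assert (HCS : (gx * ax + gy * ay) ^ 2 <= (gx ^ 2 + gy ^ 2) * (kappa * y) ^ 2).
  { rewrite <- Hacc. pose proof (pow2_ge_0 (gx * ay - gy * ax)). nra. }
  replace ((gx ^ 2 + gy ^ 2) * (kappa * y) ^ 2)
    with (kappa ^ 2 * ((y * gx) ^ 2 + (y * gy) ^ 2)) in HCS by ring.
  rewrite Hg in HCS. nra.
Qed.

Lemma cosh_gt_1 (x : R) : 0 < x -> 1 < cosh x.
Proof.
  intros Hx. unfold cosh.
  pose proof (exp_ineq1 x ltac:(lra)). pose proof (exp_ineq1 (- x) ltac:(lra)). lra.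
Qed.

Lemma cosh_pos (x : R) : 0 < cosh x.
Proof. unfold cosh. pose proof (exp_pos x). pose proof (exp_pos (- x)). lra. Qed.

(** [C t = cosh (k (t - b))] solves the equality case [C'' = k ^ 2 C]. Hence the
    Wronskian [W = f' C - f C'] is nondecreasing, and as
    [(f / C)' = W / C ^ 2], the quotient [f / C] can only decrease and then
    increase: its value at [b], which is [f b], is at most the larger of its
    values at [a] and [c]. *)
Lemma sturm_cosh_comparison (k : R) (f f' f'' : R -> R) (a b c : R) :
  (forall t, is_derive f t (f' t)) -> (forall t, is_derive f' t (f'' t)) ->
  (forall t, k ^ 2 * f t <= f'' t) -> a < b < c ->
  f b * cosh (k * (b - a)) <= f a \/ f b * cosh (k * (c - b)) <= f c.
Proof.
  intros Df Df' Hf Habc.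
  set (C := fun t => cosh (k * (t - b))). set (S := fun t => sinh (k * (t - b))).
  set (W := fun t => f' t * C t - f t * (k * S t)).
  assert (HC : forall t, 0 < C t) by (intros t; apply cosh_pos).
  assert (DW : forall t, is_derive W t ((f'' t - k ^ 2 * f t) * C t)).
  { intros t. unfold W, C, S. pose proof (Df t). pose proof (Df' t).
    auto_derive.
    - repeat split; eexists; eassumption.
    - change (Derive (fun x => f x) t) with (Derive f t).
      change (Derive (fun x => f' x) t) with (Derive f' t).
      rewrite (is_derive_unique f t (f' t)) by assumption.
      rewrite (is_derive_unique f' t (f'' t)) by assumption. unfold Rminus. ring. }
  assert (Du : forall t, is_derive (fun s => f s / C s) t (W t / C t ^ 2)).
  { intros t. pose proof (HC t). unfold W, C, S in *. pose proof (Df t).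
    auto_derive.
    - repeat split; [eexists; eassumption|]. apply Rgt_not_eq; assumption.
    - change (Derive (fun x => f x) t) with (Derive f t).
      rewrite (is_derive_unique f t (f' t)) by assumption. unfold Rminus in *. field. lra. }
  assert (Cb : C b = 1).
  { unfold C. replace (k * (b - b)) with 0 by ring. apply cosh_0. }
  destruct (MVT_cor2 _ (fun t => W t / C t ^ 2) a b ltac:(lra)
             (fun t _ => proj1 (is_derive_Reals _ _ _) (Du t))) as [s [Es Hs]].
  destruct (MVT_cor2 _ (fun t => W t / C t ^ 2) b c ltac:(lra)
             (fun t _ => proj1 (is_derive_Reals _ _ _) (Du t))) as [t [Et Ht]].
  destruct (MVT_cor2 _ _ s t ltac:(lra)
             (fun t _ => proj1 (is_derive_Reals _ _ _) (DW t))) as [r [Er Hr]].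
  assert (HW : W s <= W t).
  { assert (0 <= (f'' r - k ^ 2 * f r) * C r).
    { apply Rmult_le_pos; [specialize (Hf r); lra|apply Rlt_le, HC]. }
    nra. }
  rewrite Cb in Es, Et.
  destruct (Rle_or_lt (W s) 0) as [HWs|HWs].
  - left.
    assert (HCa : C a = cosh (k * (b - a))).
    { unfold C, cosh. replace (k * (a - b)) with (- (k * (b - a))) by ring.
      rewrite Ropp_involutive. lra. }
    rewrite <- HCa. apply Rle_div_r; [apply HC|].
    assert (W s / C s ^ 2 <= 0).
    { apply Rle_div_l; [apply pow_lt, HC|lra]. }
    nra.
  - right. change (f b * C c <= f c). apply Rle_div_r; [apply HC|].
    assert (0 < W t / C t ^ 2).
    { apply Rdiv_lt_0_compat; [lra|apply pow_lt, HC]. }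
    nra.
Qed.

(** The factor [K] is chosen before [P]; this uniformity is what makes the gap
    survive both the perturbation of [h b] and the limit [P -> infinity]. *)
Lemma hcosh_strict_quasiconvex (kappa : R) (h : R -> H2) (a b c : R) :
  0 <= kappa < 1 -> complete_curve_of_curvature kappa h -> a < b < c ->
  exists K, 1 < K /\ forall P,
    K * hcosh (h b) P <= Rmax (hcosh (h a) P) (hcosh (h c) P).
Proof.
  intros Hk [Hs [Hu Hc]] Habc.
  set (k := sqrt (1 - kappa)).
  assert (k_pos : 0 < k) by (apply sqrt_lt_R0; lra).
  assert (k_sq : k ^ 2 = 1 - kappa) by (apply pow2_sqrt; lra).
  set (K1 := cosh (k * (b - a))). set (K2 := cosh (k * (c - b))).
  assert (1 < K1) by (apply cosh_gt_1; nra).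
  assert (1 < K2) by (apply cosh_gt_1; nra).
  exists (Rmin K1 K2). split; [apply Rmin_glb_lt; assumption|].
  intros P. pose proof (hcosh_pos (h b) P) as Hpos.
  pose proof (Rmin_l K1 K2). pose proof (Rmin_r K1 K2).
  destruct (sturm_cosh_comparison k (fun t => hcosh (h t) P) _ _ a b c
              (fun t => hcosh_derive_1 h P t Hs)
              (fun t => hcosh_derive_2 h P t Hs Hu)) as [H'|H']; [|exact Habc| |].
  - intros t. rewrite k_sq.
    pose proof (hcosh_grad_acc_bound h kappa P t (proj1 Hk) (Hc t)). lra.
  - apply Rle_trans with (2 := Rmax_l _ _). fold K1 in H'. nra.
  - apply Rle_trans with (2 := Rmax_r _ _). fold K2 in H'. nra.
Qed.

Lemma hdist_near_middle_le_max (kappa : R) (h : R -> H2) (a b c : R) :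
  0 <= kappa < 1 -> complete_curve_of_curvature kappa h -> a < b < c ->
  exists eta, 0 < eta /\ forall q' P, coord_near eta (h b) q' ->
    hdist q' P <= Rmax (hdist (h a) P) (hdist (h c) P).
Proof.
  intros Hk Hh Habc.
  destruct (hcosh_strict_quasiconvex kappa h a b c Hk Hh Habc) as [K [HK HKP]].
  (* [(K - 1) / (K + 5)] is the solution of [1 + 5 eta = K (1 - eta)]. *)
  set (eta := Rmin (1 / 4) ((K - 1) / (K + 5))).
  assert (0 < (K - 1) / (K + 5)) by (apply Rdiv_lt_0_compat; lra).
  assert (0 < eta) by (apply Rmin_glb_lt; lra).
  assert (Heta4 : eta <= 1 / 4) by apply Rmin_l.
  assert (HetaK : 1 + 5 * eta <= K * (1 - eta)).
  { assert (He : eta <= (K - 1) / (K + 5)) by apply Rmin_r.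
    apply Rle_div_r in He; lra. }
  exists eta. split; [assumption|]. intros q' P Hq'.
  pose proof (hcosh_coord_near eta (h b) q' P ltac:(lra) Hq') as Hnear.
  pose proof (hcosh_pos (h b) P).
  assert (Hle : hcosh q' P <= Rmax (hcosh (h a) P) (hcosh (h c) P)).
  { apply Rle_trans with (2 := HKP P).
    apply Rmult_le_reg_l with (1 - eta); [lra|]. nra. }
  destruct (Rmax_Rle (hcosh (h a) P) (hcosh (h c) P) (hcosh q' P)) as [Hcase _].
  destruct (Hcase Hle) as [Ha|Hc].
  - apply Rle_trans with (1 := hdist_le_of_hcosh_le _ _ _ Ha), Rmax_l.
  - apply Rle_trans with (1 := hdist_le_of_hcosh_le _ _ _ Hc), Rmax_r.
Qed.

(** * Passing to horoballs *)

(** The hypothesis says that every metric ball containing [p] and [r] contains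
    [q]; horoballs inherit this as limits of balls. *)
Lemma busemann_le_max (b : H2 -> R) (p q r : H2) :
  busemann b -> (forall P, hdist q P <= Rmax (hdist p P) (hdist r P)) ->
  b q <= Rmax (b p) (b r).
Proof.
  intros [g [_ Hb]] Hball.
  assert (Lmax : is_lim (fun t => Rmax (hdist p (g t) - t) (hdist r (g t) - t)) p_infty
                   (Rmax (b p) (b r))).
  { (* [max (u, v) = (u + v + |u - v|) / 2], whose limit is known termwise. *)
    apply is_lim_ext with
      (fun t => ((hdist p (g t) - t) + (hdist r (g t) - t)
                 + Rabs ((hdist p (g t) - t) - (hdist r (g t) - t))) * / 2).
    { intros t. unfold Rmax, Rabs. destruct Rle_dec, Rcase_abs; lra. }
    replace (Rmax (b p) (b r)) with ((b p + b r + Rabs (b p - b r)) * / 2)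
      by (unfold Rmax, Rabs; destruct Rle_dec, Rcase_abs; lra).
    apply (is_lim_scal_r _ _ _ (Finite _)).
    apply (is_lim_plus' _ _ _ (b p + b r) (Rabs (b p - b r))).
    - apply is_lim_plus'; apply Hb.
    - apply (is_lim_Rabs _ _ (Finite _)). apply is_lim_minus'; apply Hb. }
  refine (is_lim_le_loc _ _ p_infty (Finite _) (Finite _) _ (Hb q) Lmax).
  exists 0. intros t _. specialize (Hball (g t)).
  destruct (Rmax_Rle (hdist p (g t)) (hdist r (g t)) (hdist q (g t))) as [Hcase _].
  destruct (Hcase Hball); [apply Rle_trans with (2 := Rmax_l _ _)
                          |apply Rle_trans with (2 := Rmax_r _ _)]; lra.
Qed.

Lemma horoconvex_closure_mem (Om : h2_set) (p q r : H2) :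
  horoconvex Om -> h2_closure Om p -> h2_closure Om r ->
  (forall P, hdist q P <= Rmax (hdist p P) (hdist r P)) -> h2_closure Om q.
Proof.
  intros [F [HF Hcl]] Hp Hr Hball. apply Hcl. intros B HB.
  destruct (HF B HB) as [b [c [Hb HBc]]].
  pose proof (proj1 (Hcl p) Hp B HB) as Bp. pose proof (proj1 (Hcl r) Hr B HB) as Br.
  apply HBc in Bp. apply HBc in Br. apply HBc.
  apply Rle_trans with (1 := busemann_le_max b p q r Hb Hball).
  apply Rmax_lub; assumption.
Qed.

(** * Exterior points near a smooth boundary *)

Lemma derive_nonzero_takes_pos (f : R -> R) (x delta : R) :
  ex_derive f x -> Derive f x <> 0 -> f x = 0 -> 0 < delta ->
  exists y, Rabs (y - x) <= delta /\ 0 < f y.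
Proof.
  intros Hex Hne H0 Hdelta.
  set (l := Derive f x) in *.
  pose proof (proj1 (is_derive_Reals _ _ _) (Derive_correct f x Hex)) as Hd.
  fold l in Hd.
  destruct (Hd (Rabs l) (Rabs_pos_lt l Hne)) as [d Hdd].
  pose proof (cond_pos d) as Hd0.
  set (m := Rmin delta (d / 2)).
  assert (Hm : 0 < m) by (apply Rmin_glb_lt; lra).
  assert (Hm1 : m <= delta) by apply Rmin_l.
  assert (Hm2 : m <= d / 2) by apply Rmin_r.
  destruct (Rlt_or_le 0 l) as [Hl|Hl].
  - exists (x + m). split.
    + apply Rabs_le. lra.
    + specialize (Hdd m ltac:(lra) ltac:(rewrite Rabs_pos_eq; lra)).
      rewrite (Rabs_pos_eq l), H0, Rminus_0_r in Hdd by lra.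
      apply Rabs_lt_between in Hdd.
      replace (f (x + m)) with (f (x + m) / m * m) by (field; lra).
      apply Rmult_lt_0_compat; lra.
  - exists (x + - m). split.
    + apply Rabs_le. lra.
    + specialize (Hdd (- m) ltac:(lra) ltac:(rewrite Rabs_Ropp, Rabs_pos_eq; lra)).
      rewrite (Rabs_left1 l), H0, Rminus_0_r in Hdd by lra.
      apply Rabs_lt_between in Hdd.
      replace (f (x + - m)) with (- (f (x + - m) / - m) * m) by (field; lra).
      apply Rmult_lt_0_compat; lra.
Qed.

(** A local defining function [F] has nonzero gradient at [q], so it takes
    positive values arbitrarily near [q], already when a single coordinate moves.
    A point where [F > 0] is neither in [Om] nor on its boundary, hence not in the
    closure. *)
Lemma smooth_boundary_exterior_point (Om : h2_set) (q : H2) (eta : R) :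
  smooth_boundary Om -> h2_boundary Om q -> 0 < eta ->
  exists q', coord_near eta q q' /\ ~ h2_closure Om q'.
Proof.
  intros Hsm Hq Heta.
  destruct (Hsm q Hq) as [U [F [HU [Uq [HF [Hgrad [HOm Hbd]]]]]]].
  destruct (HU q Uq) as [eps [Heps HUeps]].
  pose proof (hy_pos q) as Hy.
  set (e := Rmin eta (Rmin (1 / 4) (sinh (eps / 4)))).
  assert (Hsinh : 0 < sinh (eps / 4)).
  { unfold sinh. pose proof (exp_increasing (- (eps / 4)) (eps / 4) ltac:(lra)). lra. }
  assert (He : 0 < e) by (repeat apply Rmin_glb_lt; lra).
  assert (He1 : e <= eta) by apply Rmin_l.
  assert (He2 : e <= 1 / 4).
  { apply Rle_trans with (1 := Rmin_r _ _), Rmin_l. }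
  assert (He3 : e <= sinh (eps / 4)).
  { apply Rle_trans with (1 := Rmin_r _ _), Rmin_r. }
  assert (Hext : forall q', coord_near e q q' -> 0 < F (hx q') (hy q') ->
            exists q', coord_near eta q q' /\ ~ h2_closure Om q').
  { intros q' Hq' HFq'. exists q'. split.
    { destruct Hq'. split; nra. }
    assert (Uq' : U q').
    { apply HUeps.
      apply Rle_lt_trans with (1 := hdist_coord_near e q q' ltac:(lra) Hq').
      apply arcsinh_le in He3. rewrite arcsinh_sinh in He3. lra. }
    intros Hcl.
    assert (Hb : h2_boundary Om q').
    { split; [exact Hcl|]. intros d Hd. exists q'. split.
      - intros HO. apply (HOm q' Uq') in HO. lra.
      - rewrite hdist_refl. exact Hd. }
    apply (Hbd q' Uq') in Hb. lra. }
  pose proof (proj1 (Hbd q Uq) Hq) as F0.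
  destruct (HF q Uq 1%nat) as [_ [Ex [Ey _]]].
  assert (Hey : 0 < e * hy q) by nra.
  destruct (Hgrad q Uq) as [Hx|Hx].
  - destruct (derive_nonzero_takes_pos _ _ _ Ex Hx F0 Hey) as [x [Hxn HFx]].
    apply (Hext (mkH2 x (hy q) Hy)); [|exact HFx].
    split; cbn [hx hy]; [exact Hxn|]. rewrite Rminus_diag, Rabs_R0. lra.
  - destruct (derive_nonzero_takes_pos _ _ _ Ey Hx F0 Hey) as [y [Hyn HFy]].
    assert (Hy' : 0 < y).
    { apply Rabs_le_between in Hyn. nra. }
    apply (Hext (mkH2 (hx q) y Hy')); [|exact HFy].
    split; cbn [hx hy]; [|exact Hyn]. rewrite Rminus_diag, Rabs_R0. lra.
Qed.

(** * Boundary points on the curve *)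

Lemma no_boundary_point_between (Om : h2_set) (kappa : R) (h : R -> H2) (a b c : R) :
  smooth_boundary Om -> horoconvex Om -> 0 <= kappa < 1 ->
  complete_curve_of_curvature kappa h -> a < b < c ->
  h2_closure Om (h a) -> h2_closure Om (h c) -> ~ h2_boundary Om (h b).
Proof.
  intros Hsm Hho Hk Hh Habc Ha Hc Hb.
  destruct (hdist_near_middle_le_max kappa h a b c Hk Hh Habc) as [eta [Heta Hball]].
  destruct (smooth_boundary_exterior_point Om (h b) eta Hsm Hb Heta)
    as [q' [Hnear Hout]].
  apply Hout.
  apply (horoconvex_closure_mem Om (h a) q' (h c) Hho Ha Hc).
  intros P. apply Hball, Hnear.
Qed.

Theorem lemma7p1 (Om : h2_set) (kappa0 : R) (h : R -> H2)
  (Om_dom : bounded_smooth_domain Om)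
  (Om_horo : horoconvex Om)
  (kappa0_range : 0 <= kappa0 < 1)
  (h_curv : complete_curve_of_curvature kappa0 h)
  (h_emb : embedded h) :
  forall p q r : H2,
    h2_boundary Om p -> image h p ->
    h2_boundary Om q -> image h q ->
    h2_boundary Om r -> image h r ->
    p = q \/ p = r \/ q = r.
Proof.
  intros p q r Hp [s Es] Hq [t Et] Hr [u Eu]. subst p q r.
  destruct Om_dom as [_ [_ [_ Hsm]]].
  assert (Hbetween : forall a b c, h2_boundary Om (h a) -> h2_boundary Om (h b) ->
            h2_boundary Om (h c) -> a < b < c -> False).
  { intros a b c [Ha _] Hb [Hc _] Habc.
    exact (no_boundary_point_between Om kappa0 h a b c Hsm Om_horo kappa0_range h_curv
             Habc Ha Hc Hb). }
  destruct (Req_dec s t) as [->|st]; [now left|].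
  destruct (Req_dec s u) as [->|su]; [now right; left|].
  destruct (Req_dec t u) as [->|tu]; [now right; right|].
  exfalso.
  destruct (Rdichotomy s t st), (Rdichotomy s u su), (Rdichotomy t u tu); try lra;
    first
      [ apply (Hbetween s t u); (assumption || lra)
      | apply (Hbetween s u t); (assumption || lra)
      | apply (Hbetween t s u); (assumption || lra)
      | apply (Hbetween t u s); (assumption || lra)
      | apply (Hbetween u s t); (assumption || lra)
      | apply (Hbetween u t s); (assumption || lra) ].
Qed.
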